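(* Let $(\alpha_k)_{k\ge1}$ be real numbers with $\sum_{k=1}^\infty\alpha_k=1$ and $\sum_{k=1}^\infty|\alpha_k|<\infty$. If there exists $k\ge 1$ with $\alpha_k<0$, then for $\lambda>0$ sufficiently small (i.e. there is $\lambda_0>0$ such that for all $0<\lambda<\lambda_0$) the function $$\varphi_X(\theta)=\exp\Big\{\sum_{k=1}^\infty\alpha_k\lambda(e^{\mathrm{i}k\theta}-1)\Big\},\qquad \theta\in\mathbb{R},$$ is not a characteristic function.
   Context: ''Characteristic function'' means the characteristic function of an ordinary (non-negative) probability distribution on $\mathbb{R}$. *)

(* Defs.v *)
From HB Require Import structures.
From mathcomp Require Import all_boot all_order all_algebra.
From mathcomp Require Import complex.
From mathcomp Require Import all_classical all_reals all_analysis.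

Set Implicit Arguments.
Unset Strict Implicit.
Unset Printing Implicit Defensive.

Import Order.TTheory GRing.Theory Num.Theory.
Import numFieldNormedType.Exports.

Local Open Scope classical_set_scope.
Local Open Scope ring_scope.
Local Open Scope complex_scope.

(* The libraries have no exponential on R[i]; this is
   exp (a + ib) = e^a (cos b + i sin b). *)
Definition cexp (R : realType) (z : R[i]) : R[i] :=
  (expR (complex.Re z))%:C * (cos (complex.Im z) +i* sin (complex.Im z)).

(* Integral of a complex-valued function, taken componentwise. *)
Definition Cintegral (d : measure_display) (T : measurableType d)
    (R : realType) (mu : {measure set T -> \bar R}) (f : T -> R[i]) : R[i] :=
  (\int[mu]_x complex.Re (f x)) +i* (\int[mu]_x complex.Im (f x)).

Definition charfun (R : realType) (P : probability (measurableTypeR R) R)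
    (theta : R) : R[i] :=
  Cintegral P (fun x : measurableTypeR R => cexp ('i%C * (theta * x)%:C)).

Definition is_charfun (R : realType) (phi : R -> R[i]) : Prop :=
  exists P : probability (measurableTypeR R) R,
    forall theta : R, phi theta = charfun P theta.

(* R[i]^o is R[i] with the topology of the modulus, in which the series is
   summed. The value alpha 0 is not used. *)
Definition phiX (R : realType) (alpha : nat -> R) (lambda theta : R) : R[i] :=
  cexp (limn (fun n => \sum_(1 <= k < n)
    ((alpha k * lambda)%:C * (cexp ('i%C * (k%:R * theta)%:C) - 1) : R[i]^o))).

(* Main.v *)
(* Sampling at the N-th roots of unity makes positive-definiteness a statement
   about the aliased Fourier coefficients of phi_X. With t_j = 2 pi j / N and
   s = t_j - t_l, if phi_X is the characteristic function of X then
     sum_{j,l} Re (e^{-i s n} phi_X(s)) = E |sum_j e^{i t_j (X - n)}|^2 >= 0.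
   The left-hand side is a function F of lambda with F(0) = 0 (as 0 < n < N) and
     F'(0) = sum_k alpha_k |sum_j e^{i t_j (k - n)}|^2
           = N^2 sum_{k = n mod N} alpha_k.
   When alpha_n < 0 and N is so large that sum_{k >= N} |alpha_k| <= -alpha_n/2,
   F'(0) < 0, hence F(lambda) < 0 for all small lambda > 0. *)

Require Import Defs.
From mathcomp Require Import all_boot all_order all_algebra.
From mathcomp Require Import complex.
From mathcomp Require Import all_classical all_reals all_analysis.
From mathcomp Require Import ring lra.

Import Order.TTheory GRing.Theory Num.Theory.
Import numFieldNormedType.Exports.
Local Open Scope classical_set_scope.
Local Open Scope ring_scope.

(** Both sides are |sum_i e^{i t_i z}|^2; the cosine of a difference splits the double sum into two
    products of equal sums. *)
Lemma cos_gram (R : realType) (I : finType) (t : I -> R) (z : R) :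
  \sum_(p : I * I) cos ((t p.1 - t p.2) * z) =
    (\sum_i cos (t i * z)) ^+ 2 + (\sum_i sin (t i * z)) ^+ 2.
Proof.
rewrite !expr2 !big_distrlr /= !pair_big /= -big_split /=.
by apply: eq_bigr => p _; rewrite mulrBl cosB.
Qed.

(** * Real and imaginary parts of [phiX] *)

Lemma cvg_complex (R : realType) (a b : nat -> R) (x y : R) :
    a n @[n --> \oo] --> x -> b n @[n --> \oo] --> y ->
  ((a n +i* b n)%C : R[i]^o) @[n --> \oo] --> ((x +i* y)%C : R[i]^o).
Proof.
move=> ax by_; apply/cvgrPdist_lt => e e0.
(* A positive element of [R[i]] is real, so the radius can be taken in [R]. *)
have [e' e'0 ->] : exists2 e' : R, 0 < e' & e = (e'%:C)%C.
  exists (complex.Re e); last by rewrite RRe_real// gtr0_real.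
  by rewrite -ltcR RRe_real// gtr0_real.
have e20 : 0 < e' / 2 by rewrite divr_gt0.
near=> n.
have Ha : `|x - a n| < e' / 2 by near: n; move/cvgrPdist_lt : ax; apply.
have Hb : `|y - b n| < e' / 2 by near: n; move/cvgrPdist_lt : by_; apply.
have -> : (x +i* y)%C - (a n +i* b n)%C = ((x - a n) +i* (y - b n))%C by [].
rewrite normc_def /= ltcR.
apply: (@le_lt_trans _ _ (`|x - a n| + `|y - b n|)); last by lra.
rewrite -[leRHS]ger0_norm ?addr_ge0// -sqrtr_sqr ler_wsqrtr//.
rewrite [leRHS]sqrrD !real_normK ?num_real// addrAC lerDl.
by rewrite mulrn_wge0// mulr_ge0.
Unshelve. all: by end_near. Qed.

Lemma cexp_i (R : realType) (x : R) :
  cexp ('i * x%:C)%C = (cos x +i* sin x)%C.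
Proof.
have -> : ('i * x%:C)%C = (0 +i* x)%C :> R[i].
  by rewrite /=; simpc.
by rewrite /cexp /= expR0 mul1r.
Qed.

Lemma sum_complex (R : realType) (I : Type) (r : seq I) (P : pred I)
    (f g : I -> R) :
  \sum_(i <- r | P i) (f i +i* g i)%C =
    ((\sum_(i <- r | P i) f i) +i* (\sum_(i <- r | P i) g i))%C.
Proof.
elim: r => [|i r IH]; first by rewrite !big_nil.
by rewrite !big_cons; case: (P i); rewrite IH.
Qed.

(** Here w + iv is the sum of the alpha_k (e^{ik theta} - 1); factoring [lambda] out of the limit
    makes the dependence on it explicit, ready for differentiation. *)
Lemma phiXE (R : realType) (alpha : nat -> R) (lambda theta w v : R) :
    (\sum_(1 <= k < n) alpha k * (cos (k%:R * theta) - 1)) @[n --> \oo] --> w ->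
    (\sum_(1 <= k < n) alpha k * sin (k%:R * theta)) @[n --> \oo] --> v ->
  phiX alpha lambda theta =
    (expR (lambda * w) * cos (lambda * v)
     +i* (expR (lambda * w) * sin (lambda * v)))%C.
Proof.
move=> cw cv; rewrite /phiX.
set u := (X in limn X).
have uE : u = fun n =>
    ((lambda * \sum_(1 <= k < n) alpha k * (cos (k%:R * theta) - 1))
     +i* (lambda * \sum_(1 <= k < n) alpha k * sin (k%:R * theta)))%C : R[i]^o.
  apply/funext => n; rewrite /u !mulr_sumr -sum_complex.
  apply: eq_bigr => k _; rewrite cexp_i.
  by apply/eqP; rewrite eq_complex /=; apply/andP; split; apply/eqP; ring.
have -> : limn u = ((lambda * w) +i* (lambda * v))%C.
  by rewrite uE; apply: cvg_lim => //; apply: cvg_complex; apply: cvgMl_tmp.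
by rewrite /cexp /=; simpc.
Qed.

(** * Positive-definiteness of characteristic functions *)

Lemma integrable_cos (R : realType) (P : probability (measurableTypeR R) R)
    (s c : R) :
  P.-integrable setT (EFin \o (fun x : measurableTypeR R => cos (s * x + c))).
Proof.
apply: measurable_bounded_integrable => //.
- by rewrite (le_lt_trans (probability_le1 P _)) ?ltry.
- apply: measurable_realfun.continuous_measurable_fun => x.
  apply: continuous_comp; last exact: continuous_cos.
  by apply: cvgD; [apply: cvgMl_tmp; exact: cvg_id|exact: cvg_cst].
- exists 1; split => // M M1 x _; apply: le_trans (ltW M1); exact: cos_max.
Qed.

Lemma Rintegral_sum (d : measure_display) (T : measurableType d) (R : realType)
    (mu : {measure set T -> \bar R}) (D : set T) (I : Type) (r : seq I)
    (f : I -> T -> R) : measurable D ->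
    (forall i, mu.-integrable D (EFin \o f i)) ->
  \int[mu]_(x in D) (\sum_(i <- r) f i x) =
    \sum_(i <- r) \int[mu]_(x in D) f i x.
Proof.
move=> mD intf; rewrite /Rintegral.
under eq_integral do rewrite -sumEFin.
rewrite integral_sum// -sum_fine// => i _.
exact: (integrable_fin_num mD (intf i)).
Qed.

(** The left-hand side is the real part of e^{ic} times the characteristic function at [s]. *)
Lemma cos_combination_charfun (R : realType)
    (P : probability (measurableTypeR R) R) (s c : R) :
  cos c * complex.Re (charfun P s) - sin c * complex.Im (charfun P s) =
    \int[P]_x cos (s * x + c).
Proof.
have -> : complex.Re (charfun P s) = \int[P]_x cos (s * x).
  by apply: eq_Rintegral => x _; rewrite cexp_i.
have -> : complex.Im (charfun P s) = \int[P]_x sin (s * x).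
  by apply: eq_Rintegral => x _; rewrite cexp_i.
have ic : P.-integrable setT
    (EFin \o (fun x : measurableTypeR R => cos (s * x))).
  by have := integrable_cos R P s 0; under eq_fun do rewrite /= addr0.
have isin : P.-integrable setT
    (EFin \o (fun x : measurableTypeR R => sin (s * x))).
  (* The sine is the cosine with phase -pi/2. *)
  have := integrable_cos R P s (- (pi / 2)).
  by under eq_fun do rewrite /= cosBpihalf.
under [RHS]eq_Rintegral do rewrite cosD mulrC [_ * sin c]mulrC.
have icc : P.-integrable setT
    (EFin \o (fun x : measurableTypeR R => cos c * cos (s * x))).
  exact: (integrableZl measurableT (cos c) ic).
have iss : P.-integrable setT
    (EFin \o (fun x : measurableTypeR R => sin c * sin (s * x))).
  exact: (integrableZl measurableT (sin c) isin).
by rewrite RintegralB ?RintegralZl.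
Qed.

Lemma charfun_psd (R : realType) (P : probability (measurableTypeR R) R)
    (I : finType) (t : I -> R) (y : R) :
  0 <= \sum_(p : I * I)
    (cos (- ((t p.1 - t p.2) * y)) * complex.Re (charfun P (t p.1 - t p.2))
     - sin (- ((t p.1 - t p.2) * y)) * complex.Im (charfun P (t p.1 - t p.2))).
Proof.
under eq_bigr do rewrite cos_combination_charfun.
rewrite -Rintegral_sum//; last by move=> p; exact: integrable_cos.
apply: Rintegral_ge0 => x _.
under eq_bigr do rewrite -mulrBr.
by rewrite cos_gram addr_ge0// sqr_ge0.
Qed.

(** * Sums over roots of unity *)

Lemma shift_sum (V : zmodType) (f : nat -> V) (N : nat) : f N = f 0%N ->
  \sum_(j < N) f j.+1 = \sum_(j < N) f j.
Proof.
move=> fN; apply: (@addrI _ (f 0%N)).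
by rewrite -(big_ord_recl N (fun i => f i)) big_ord_recr /= fN addrC.
Qed.

(* The rotation by x permutes the points of angles j x, so it fixes their sum;
   a nontrivial rotation fixes only 0. *)
Lemma cos_sin_sum0 (R : realType) (N : nat) (x : R) :
    cos (N%:R * x) = 1 -> sin (N%:R * x) = 0 -> cos x != 1 ->
  (\sum_(j < N) cos (j%:R * x)) ^+ 2 + (\sum_(j < N) sin (j%:R * x)) ^+ 2 = 0.
Proof.
move=> cN sN cx1.
have HC := @shift_sum R (fun j => cos (j%:R * x)) N.
have HS := @shift_sum R (fun j => sin (j%:R * x)) N.
rewrite /= cN sN mul0r cos0 sin0 in HC HS.
move: (HC erefl) (HS erefl).
under eq_bigr do rewrite -natr1 mulrDl mul1r cosD.
under [X in _ -> X = _ -> _]eq_bigr do rewrite -natr1 mulrDl mul1r sinD.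
rewrite sumrB big_split /= -!mulr_suml.
set C := \sum_(j < N) cos _; set S := \sum_(j < N) sin _ => eC eS.
(* [eC] and [eS] say that the rotation fixes (C, S); pairing them with [C] and [S] cancels the sine
   terms. *)
apply/eqP; have : (cos x - 1) * (C ^+ 2 + S ^+ 2) == 0.
  have -> : (cos x - 1) * (C ^+ 2 + S ^+ 2) =
    (C * cos x - S * sin x - C) * C + (S * cos x + C * sin x - S) * S by ring.
  by rewrite eC eS !subrr !mul0r addr0.
by rewrite mulf_eq0 subr_eq0 (negbTE cx1).
Qed.

(** 1 - cos x = 2 sin^2(|x|/2), and |x|/2 lies strictly between 0 and pi. *)
Lemma cos_neq1 (R : realType) (x : R) : 0 < `|x| < pi *+ 2 -> cos x != 1.
Proof.
move=> /andP[x0 x2].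
have -> : cos x = cos `|x|.
  by case: (ger0P x) => // _; rewrite cosN.
have s0 : 0 < sin (`|x| / 2).
  by apply: sin_gt0_pi; rewrite divr_gt0//= ltr_pdivrMr// mulr_natr.
rewrite [`|x|]splitr -mulr2n cos_mulr2n.
have := cos2Dsin2 (`|x| / 2); have := exprn_gt0 2 s0.
by move=> *; apply/eqP; lra.
Qed.

Definition root_angle (R : realType) (N : nat) (j : 'I_N) : R :=
  j%:R * (pi *+ 2 / N%:R).

(* The squared modulus of sum_j e^{i t_j z}, by [cos_gram]. *)
Definition root_sum (R : realType) (N : nat) (z : R) : R :=
  \sum_(p : 'I_N * 'I_N) cos ((root_angle R N p.1 - root_angle R N p.2) * z).

Lemma root_sum_eq0 (R : realType) (N k n : nat) :
  (k < N)%N -> (n < N)%N -> k != n -> root_sum R N (k%:R - n%:R) = 0.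
Proof.
move=> kN nN kn; rewrite /root_sum cos_gram.
have N0 : (0 : R) < N%:R by rewrite ltr0n (leq_ltn_trans _ kN).
set x := pi *+ 2 / N%:R * (k%:R - n%:R) : R.
under eq_bigr do rewrite /root_angle -mulrA -/x.
under [X in _ + X ^+ 2]eq_bigr do rewrite /root_angle -mulrA -/x.
(* [k] - [n] may be negative, so full turns are added and removed separately, each a natural number
   of periods. *)
have Nx : N%:R * x = 0 + (pi *+ 2) *+ k - (pi *+ 2) *+ n.
  by rewrite /x; field; rewrite gt_eqF.
have pc := periodicn (@cosD2pi R); have ps := periodicn (@sinD2pi R).
apply: cos_sin_sum0.
- by rewrite Nx -(pc n) subrK pc cos0.
- by rewrite Nx -(ps n) subrK ps sin0.
have p0 : 0 < pi *+ 2 :> R by rewrite mulrn_wgt0 ?pi_gt0.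
have kn0 : 0 < `|k%:R - n%:R| :> R by rewrite normr_gt0 subr_eq0 eqr_nat.
have knN : `|k%:R - n%:R| < N%:R :> R.
  rewrite ltr_norml ltrBlDr ltrBrDl -natrD.
  have := ltr_nat R k N; have := ltr_nat R n N; rewrite kN nN.
  by have := ler0n R k; have := ler0n R n; rewrite natrD; move=> *; lra.
apply: cos_neq1; rewrite /x normrM gtr0_norm ?divr_gt0// mulr_gt0 ?divr_gt0//=.
by rewrite mulrAC ltr_pdivrMr// ltr_pM2l.
Qed.

Lemma root_sum0 (R : realType) (N : nat) : root_sum R N 0 = (N ^ 2)%:R.
Proof.
rewrite /root_sum; under eq_bigr do rewrite mulr0 cos0.
by rewrite sumr_const card_prod card_ord mulnn.
Qed.

Lemma root_sum_ge0 (R : realType) (N : nat) (z : R) : 0 <= root_sum R N z.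
Proof. by rewrite /root_sum cos_gram addr_ge0// sqr_ge0. Qed.

Lemma root_sum_le (R : realType) (N : nat) (z : R) :
  root_sum R N z <= (N ^ 2)%:R.
Proof.
rewrite -root_sum0; apply: ler_sum => p _.
by rewrite mulr0 cos0 cos_le1.
Qed.

(** * Absolutely convergent series and their tails *)

Lemma sum_from1_series (V : nmodType) (f : nat -> V) (n : nat) :
  \sum_(1 <= k < n) f k = \sum_(0 <= k < n) (f k *+ (0 < k)%N).
Proof.
case: n => [|n]; first by rewrite !big_geq.
rewrite [RHS]big_ltn// mulr0n add0r; apply: eq_big_nat => k /andP[k0 _].
by rewrite k0.
Qed.

Lemma nondecreasing_abs (R : realType) (alpha : nat -> R) :
  nondecreasing_seq (fun n => \sum_(1 <= k < n) `|alpha k|).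
Proof.
apply/nondecreasing_seqP => n; case: n => [|n]; first by rewrite !big_geq.
by rewrite [leRHS]big_nat_recr//= lerDl.
Qed.

Lemma cvg_abs (R : realType) (alpha : nat -> R) :
    (\sum_(1 <= k <oo) `|alpha k|%:E < +oo)%E ->
  cvgn (fun n => \sum_(1 <= k < n) `|alpha k|).
Proof.
move=> fin; apply: nondecreasing_is_cvgn; first exact: nondecreasing_abs.
exists (fine (\sum_(1 <= k <oo) `|alpha k|%:E)%E) => _ [n _ <-].
rewrite -lee_fin fineK; last first.
  by rewrite ge0_fin_numE// nneseries_ge0// => k _ _; rewrite lee_fin.
by rewrite -sumEFin; apply: nneseries_lim_ge => k _ _; rewrite lee_fin.
Qed.

(** Comparison with the series of M |alpha_k|; it serves for the weights cos - 1 and sin. *)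
Lemma cvg_weighted (R : realType) (alpha g : nat -> R) (M : R) :
    (\sum_(1 <= k <oo) `|alpha k|%:E < +oo)%E -> (forall k, `|g k| <= M) ->
  cvgn (fun n => \sum_(1 <= k < n) alpha k * g k).
Proof.
move=> /cvg_abs abs gM.
under eq_fun do rewrite sum_from1_series.
apply: normed_cvg => /=.
apply: (@series_le_cvg _ _ (fun k => M * (`|alpha k| *+ (0 < k)%N))) => //.
- by move=> k /=; exact: normr_ge0.
- move=> k; apply: mulr_ge0; [exact: le_trans (gM 0%N)|exact: mulrn_wge0].
- by move=> k /=; rewrite normrMn normrM mulrnAr mulrC lerMn2r ler_wpM2r ?orbT.
apply: (@is_cvg_seriesZ R (fun k => `|alpha k| *+ (0 < k)%N) M).
by move: abs; under eq_fun do rewrite sum_from1_series.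
Qed.

Lemma abs_tail (R : realType) (alpha : nat -> R) (e : R) :
    (\sum_(1 <= k <oo) `|alpha k|%:E < +oo)%E -> 0 < e ->
  exists M : nat, forall N K, (M <= N)%N -> \sum_(N <= k < K) `|alpha k| <= e.
Proof.
move=> /cvg_abs /cvg_ex[l al] e0.
have : \forall n \near \oo, l - e < \sum_(1 <= k < n) `|alpha k|.
  by apply: (cvgr_gt _ al); rewrite ltrBlDr ltrDl.
(* The successor keeps [N] positive, so that the sum from 1 can be split at [N]. *)
move=> [M _ aM]; exists M.+1 => N K MN.
have [KN|/ltnW NK] := leqP K N; first by rewrite big_geq// ltW.
have N0 : (0 < N)%N by exact: leq_trans MN.
have aK : \sum_(1 <= k < K) `|alpha k| <= l.
  rewrite -(cvg_lim _ al)//; apply: (nondecreasing_cvgn_le _ _ K).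
    exact: nondecreasing_abs.
  by apply/cvg_ex; exists l.
have := aM _ (ltnW MN); rewrite /= => aN.
move: aK; rewrite (big_cat_nat _ NK)//= => aK.
by lra.
Qed.

(** * Sign near 0 from the derivative at 0 *)

Lemma exp_cos_sum_neg (R : realType) (I : finType) (w v c : I -> R) :
    \sum_i cos (c i) = 0 -> \sum_i (w i * cos (c i) + v i * sin (c i)) < 0 ->
  exists2 lambda0 : R, 0 < lambda0 & forall lambda : R,
    0 < lambda -> lambda < lambda0 ->
    \sum_i expR (lambda * w i) * cos (lambda * v i - c i) < 0.
Proof.
move=> c0 d0.
set f := fun x : R => \sum_i expR (x * w i) * cos (x * v i - c i).
have f0 : f 0 = 0.
  rewrite -[RHS]c0; apply: eq_bigr => i _.
  by rewrite !mul0r expR0 mul1r sub0r cosN.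
have df : is_derive (0 : R) 1 f (\sum_i (w i * cos (c i) + v i * sin (c i))).
  have -> : f = \sum_i (fun x : R => expR (x * w i) * cos (x * v i - c i)).
    by apply/funext => x; rewrite fct_sumE.
  apply: (big_ind2 (fun g l => is_derive (0 : R) 1 g l)).
  - exact: is_derive_cst.
  - by move=> g1 l1 g2 l2 h1 h2; exact: is_deriveD.
  (* At 0 the product rule gives w cos(-c) - v sin(-c). *)
  move=> i _; apply: is_derive_eq.
  rewrite /= !mul0r !add0r !scaler0 !(add0r, addr0) sinN cosN expR0.
  rewrite /GRing.scale /=.
  by ring.
have : h^-1 *: ((f \o shift 0) (h *: 1) - f 0) @[h --> (0 : R)^'] -->
    \sum_i (w i * cos (c i) + v i * sin (c i)).
  by rewrite -(@derive_val _ _ _ _ _ _ _ df); exact: ex_derive.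
(* The difference quotient f(h)/h is negative for small nonzero h, so f(h) < 0 when moreover h >
   0. *)
move=> /cvgr_lt/(_ _ d0) => /nbhs_ballP[e /= e0 he].
exists e => // x x0 xe.
have := he x; rewrite /ball /= sub0r normrN gtr0_norm// => /(_ xe).
rewrite gt_eqF// => /(_ isT).
by rewrite addr0 f0 subr0 /GRing.scale /= mulr1 pmulr_rlt0 ?invr_gt0.
Qed.

Theorem corollary4p2 (R : realType) (alpha : nat -> R)
    (sum_alpha : (\sum_(1 <= k < n) alpha k) @[n --> \oo] --> (1 : R))
    (abs_alpha : (\sum_(1 <= k <oo) `|alpha k|%:E < +oo)%E)
    (neg_alpha : exists2 k : nat, (1 <= k)%N & alpha k < 0) :
  exists2 lambda0 : R, 0 < lambda0 &
    forall lambda : R, 0 < lambda -> lambda < lambda0 ->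
      ~ is_charfun (phiX alpha lambda).
Proof.
have {neg_alpha}[n n1 an] := neg_alpha.
(* The tail may cancel at most half of the negative contribution of [alpha n]. *)
have [M tail] : exists M : nat, forall N K, (M <= N)%N ->
    \sum_(N <= k < K) `|alpha k| <= - alpha n / 2.
  by apply: abs_tail => //; rewrite divr_gt0// oppr_gt0.
pose N := maxn M n.+1.
have nN : (n < N)%N by rewrite leq_max leqnn orbT.
have N0 : (0 < N)%N by exact: leq_ltn_trans nN.
pose s (p : 'I_N * 'I_N) : R := root_angle R N p.1 - root_angle R N p.2.
pose uk t k : R := cos (k%:R * t) - 1.
pose vk t k : R := sin (k%:R * t).
have cu t : cvgn (fun K => \sum_(1 <= k < K) alpha k * uk t k).
  apply: (cvg_weighted _ _ _ 2 abs_alpha) => k.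
  have := cos_geN1 (k%:R * t); have := cos_le1 (k%:R * t).
  by rewrite /uk ler_norml; move=> *; apply/andP; split; lra.
have cv t : cvgn (fun K => \sum_(1 <= k < K) alpha k * vk t k).
  by apply: (cvg_weighted _ _ _ 1 abs_alpha) => k; rewrite /vk sin_max.
pose w t := limn (fun K => \sum_(1 <= k < K) alpha k * uk t k).
pose v t := limn (fun K => \sum_(1 <= k < K) alpha k * vk t k).
pose c p := s p * n%:R.
(* F(0) = 0: this is the root sum for frequency 0, and 0 and [n] are distinct residues mod [N]. *)
have c0 : \sum_p cos (c p) = 0.
  have n0 : 0%N != n by rewrite eq_sym -lt0n.
  apply: etrans (root_sum_eq0 R N 0 n N0 nN n0).
  by apply: eq_bigr => p _; rewrite sub0r mulrN cosN.
(* [D K] truncates F'(0) at [K], so that the sums over [k] and over pairs are finite and can be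
   exchanged. *)
pose D K : R := \sum_p ((\sum_(1 <= k < K) alpha k * uk (s p) k) * cos (c p) +
    (\sum_(1 <= k < K) alpha k * vk (s p) k) * sin (c p)).
have cD : D K @[K --> \oo] -->
    \sum_p (w (s p) * cos (c p) + v (s p) * sin (c p)).
  rewrite /D; apply: cvg_big => [|p _]; first exact: add_continuous.
  by apply: cvgD; apply: cvgMr_tmp; [exact: cu|exact: cv].
have DE K : D K = \sum_(1 <= k < K) alpha k * root_sum R N (k%:R - n%:R).
  rewrite /D; under eq_bigr do rewrite !mulr_suml -big_split /=.
  rewrite exchange_big /=; apply: eq_bigr => k _.
  (* Subtracting the zero sum [c0] produces the -1 in [uk]. *)
  rewrite -[in RHS](subr0 (root_sum _ _ _)) -[X in _ - X]c0 -sumrB mulr_sumr.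
  apply: eq_bigr => p _.
  rewrite -/(s p) [s p * _]mulrBr -/(c p) cosB /uk /vk [s p * k%:R]mulrC.
  by ring.
(* Below [N] only k = n survives, giving N^2 alpha_n; from [N] on each root sum lies in [0, N^2], so
   the tail adds at most -N^2 alpha_n / 2. *)
have Dle K : (N <= K)%N -> D K <= (N ^ 2)%:R * (alpha n / 2).
  move=> NK; rewrite DE (big_cat_nat _ NK)//=.
  have -> : \sum_(1 <= k < N) alpha k * root_sum R N (k%:R - n%:R) =
      alpha n * (N ^ 2)%:R.
    rewrite (bigD1_seq n) ?mem_index_iota ?n1 ?iota_uniq//= subrr root_sum0.
    rewrite big_nat_cond big1 ?addr0// => k /andP[/andP[_ kN] kn].
    by rewrite root_sum_eq0 ?mulr0.
  have : \sum_(N <= k < K) alpha k * root_sum R N (k%:R - n%:R) <=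
      (- alpha n / 2) * (N ^ 2)%:R.
    apply: (@le_trans _ _ (\sum_(N <= k < K) `|alpha k| * (N ^ 2)%:R)).
      apply: ler_sum => k _; apply: (le_trans (ler_norm _)).
      by rewrite normrM ler_wpM2l// ger0_norm ?root_sum_ge0 ?root_sum_le.
    by rewrite -mulr_suml ler_wpM2r// tail// leq_maxl.
  by move=> h; rewrite -lerBrDl (le_trans h)//; lra.
have d0 : \sum_p (w (s p) * cos (c p) + v (s p) * sin (c p)) < 0.
  (* A bound uniform in [K] and itself negative keeps the limit strictly negative. *)
  apply: (@le_lt_trans _ _ ((N ^ 2)%:R * (alpha n / 2))).
    by apply: (cvgr_to_le cD); exists N.
  by rewrite pmulr_rlt0 ?ltr0n ?expn_gt0 ?N0// ltr_pdivrMr ?mul0r.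
have [lambda0 l0 neg] := exp_cos_sum_neg R _ _ _ c c0 d0.
exists lambda0 => // lambda lam0 lamlt [P Pphi].
(* At y = n the nonnegative sum is exactly the one that [neg] makes negative. *)
have := charfun_psd R P _ (@root_angle R N) n%:R.
rewrite leNgt => /negP; apply.
rewrite (le_lt_trans _ (neg _ lam0 lamlt))// le_eqVlt.
apply/orP; left; apply/eqP.
apply: eq_bigr => p _; rewrite -Pphi (@phiXE _ _ _ _ (w (s p)) (v (s p))) /=.
- by rewrite cosN sinN cosB -/(s p) -/(c p); ring.
- exact: cu.
- exact: cv.
Qed.
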